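(* Let $k$ be a field, let $(\Lambda,G,\eta)$ be an admissible set of data, $L=\Lambda/G$, let $A=A(\Lambda,G,\eta)$ be its algebra of conjugacy classes of partial elements over $k$, and let $\hat A=\prod_{l\in L}Z(k[G_l])$. The linear map $\varphi:A\to\hat A$ defined by $\varphi(e_{(l',c)})=\sum_{l\succeq l'}\xi(l',c;l)\,e_{c(l)}$ is a monomorphism of algebras.
   Context: Admissible poset: a poset $\Lambda$ with a minimal element $0$ (so $0\preceq\lambda$ for all $\lambda$), such that $\{\lambda'\mid\lambda'\preceq\lambda\}$ is finite for each $\lambda$ and each finite subset has a supremum. The supremum of $\lambda',\lambda''$ is denoted $\lambda'\wedge\lambda''$. Let $G$ be a group acting on $\Lambda$ by order automorphisms, let $\mathrm{Sub}(G)$ be the poset of subgroups of $G$ (ordered by inclusion, $G$ acting by conjugation), and let $\eta:\Lambda\to\mathrm{Sub}(G)$, $\lambda\mapsto G_\lambda$, be order preserving and $G$-equivariant ($G_{g\lambda}=gG_\lambda g^{-1}$). Put $L=\Lambda/G$, with $l'\preceq l''$ iff $\lambda'\preceq\lambda''$ for some $\lambda'\in l',\lambda''\in l''$. For $l',l''\in L$, $l'\wedge l''\subset L$ is the set of orbits of all elements $\lambda'\wedge\lambda''$, $\lambda'\in l'$, $\lambda''\in l''$. $G_l$ denotes the conjugacy class of the subgroups $G_\lambda$, $\lambda\in l$ (or a representative of it). A partial element is a pair $(\lambda,h)$ with $\lambda\in\Lambda$, $h\in G_\lambda$; $G$ acts on partial elements by $g(\lambda,h)=(g\lambda,ghg^{-1})$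 (conjugation), and orbits are called conjugacy classes of partial elements. $(\Lambda,G,\eta)$ is an admissible set of data if $\Lambda$ is admissible and: (1) $G_0=\{e\}$; (2) every $G_\lambda$ is finite; (3) $l'\wedge l''$ is a finite set for all $l',l''\in L$; (4) if $l'\wedge x=l''\wedge x$ for all $x\in L$ and $G_{l'}=G_{l''}$, then $l'=l''$; (5) for any $\lambda',\lambda''\preceq\lambda$, any two partial elements $(\lambda',h'),(\lambda'',h'')$ conjugated by an element of $G$ are conjugated by an element of $G_\lambda$. Standing assumptions: $G=\bigcup_\lambda G_\lambda$; each $G_\lambda$ maps $\{\mu\mid\mu\preceq\lambda\}$ to itself (equivalently, fixes $\lambda$); for each conjugacy class $c$ of $G$ and each $\lambda$, $c\cap G_\lambda$ is empty or a single conjugacy class of $G_\lambda$. For $l\in L$ and a conjugacy class $c$ of $G$, let $(l,c)=\{(\lambda,h)\mid\lambda\in l,\ h\in c\cap G_\lambda\}$; it is empty or a conjugacy class of partial elements, and every conjugacy class of partial elements has this form. Partial elements are multiplied by $(\lambda',h')(\lambda'',h'')=(\lambda'\wedge\lambda'',h'h'')$. $e_{(l,c)}$ is the formal sum of all elements of $(l,c)$ ($e_{(l,c)}=0$ if $(l,c)=\emptyset$). $A$ is the $k$-vector space with basis the nonzero $e_{(l,c)}$, a commutative associative algebra under the multiplication induced by that of partial elements. For $c$ meeting $G_\lambda$ ($\lambda\in l$), $c(l)=c(\lambda)=c\cap G_\lambda$, and $e_{c(l)}\in Z(k[G_l])$ is the sum of its elements (here $Z(k[G_l])$ is the center of the group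 algebra $k[G_\lambda]$, $\lambda\in l$; these are canonically identified for all $\lambda\in l$ by matching the elements $e_{c(\lambda)}$); $e_{c(l)}=0$ if $c\cap G_\lambda=\emptyset$. For $l',l\in L$, $\xi(l',c;l)$ is the number of $\lambda'\in l'$ with $\lambda'\preceq\lambda$ and $h\in G_{\lambda'}$, where $\lambda\in l$ and $h\in c\cap G_\lambda$ are fixed (independent of the choice; $0$ if $c\cap G_\lambda=\emptyset$). $\hat A$ has componentwise multiplication; its elements are written as possibly infinite sums $\sum_{l}a_l$, $a_l\in Z(k[G_l])$. *)

(* Defs.v *)
From HB Require Import structures.
From mathcomp Require Import all_boot all_order all_algebra finmap.
From mathcomp Require Import all_classical.

Set Implicit Arguments.
Unset Strict Implicit.
Unset Printing Implicit Defensive.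
Import Order.TTheory GRing.Theory.

Local Open Scope classical_set_scope.
Local Open Scope quotient_scope.
Local Open Scope ring_scope.

(** * Formal sums over a monoid with finite factorizations

   When every element has finitely many factorizations into two factors, the
   possibly infinite formal sums [\sum_m a_m m] form an algebra under the
   product induced by that of the monoid. Over a finite group this is the group
   algebra. *)

HB.mixin Record hasFiniteFactorizations M of Monoid M := {
  finite_factorizations :
    forall m : M, finite_set [set p : M * M | (p.1 * p.2)%g = m]
}.
#[short(type="ffMonoidType")]
HB.structure Definition FFMonoid := {M of hasFiniteFactorizations M & Monoid M}.

Definition formalSum (k M : Type) : Type := M -> k.

Section FormalSums.
Variables (k : fieldType) (M : ffMonoidType).
Implicit Types (a b c : formalSum k M) (m : M).

HB.instance Definition _ := GRing.Lmodule.copy (formalSum k M) (M -> k^o).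

Definition fs_one : formalSum k M := fun m => (m == 1%g)%:R.

Definition fs_mul a b : formalSum k M :=
  fun m => \sum_(p \in [set p : M * M | (p.1 * p.2)%g = m]) a p.1 * b p.2.

Let factor m (x : M) := exists y z, (y * x * z)%g = m.

Let factor_finite m : finite_set (factor m).
Proof.
pose F m := [set p : M * M | (p.1 * p.2)%g = m].
have fF n : finite_set (F n) by exact: finite_factorizations.
have fU : finite_set (\bigcup_(p in F m) [set q.2 | q in F p.1]).
  by apply: bigcup_finite => // p _; exact: finite_image.
apply: sub_finite_set fU => x [y [z e]].
by exists ((y * x)%g, z) => //; exists (y, x).
Qed.

Let fs_mulE (S : seq M) m a b : uniq S -> (forall x, factor m x -> x \in S) ->
  fs_mul a b m =
  \sum_(x <- S) \sum_(y <- S) (if (x * y)%g == m then a x * b y else 0).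
Proof.
move=> uS mS; pose F (p : M * M) := a p.1 * b p.2.
pose r := [seq (x, y) | x <- S, y <- S].
transitivity (\sum_(p <- r | (p.1 * p.2)%g == m) F p); last first.
  by rewrite big_mkcond big_allpairs.
rewrite bigfs; last 2 first.
- by apply: allpairs_uniq => // -[? ?] [? ?] _ _ [-> ->].
- move=> [x y] /eqP /= e /negP[]; apply: allpairs_f; apply: mS.
    by exists 1%g, y; rewrite mul1g.
  by exists x, 1%g; rewrite mulg1.
by apply: eq_fsbigl; apply/seteqP; split => p /= /eqP.
Qed.

Let supp m : exists2 S : seq M, uniq S & forall x, factor m x <-> x \in S.
Proof.
exists (fset_set (factor m)) => [|x]; first exact: fset_uniq.
by rewrite in_fset_set ?inE.
Qed.

Let fs_mulA : associative fs_mul.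
Proof.
move=> a b c; apply/funext => m; have [S uS mS] := supp m.
have mS1 x : factor m x -> x \in S by move/mS.
have mS2 x y : x \in S -> factor x y -> y \in S.
  move=> /mS[u [v e]] [u' [v' e']]; apply/mS.
  by exists (u * u')%g, (v' * v)%g; rewrite -e -e' !mulgA.
pose T (x y z : M) := a x * b y * c z.
transitivity (\sum_(x <- S) \sum_(y <- S) \sum_(z <- S)
    (if (x * y * z)%g == m then T x y z else 0)).
  rewrite (fs_mulE _ _ uS mS1); apply: eq_big_seq => x xS.
  transitivity (\sum_(w <- S) \sum_(y <- S) \sum_(z <- S)
     (if (x * w)%g == m then if (y * z)%g == w then T x y z else 0 else 0)).
    apply: eq_big_seq => w wS; case: eqP => _; last first.
      by rewrite big1 // => y _; rewrite big1.
    rewrite (fs_mulE _ _ uS); last by move=> ?; exact: mS2.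
    rewrite mulr_sumr; apply: eq_bigr => y _.
    rewrite mulr_sumr; apply: eq_bigr => z _.
    by rewrite (fun_if (fun t => a x * t)) mulr0 mulrA.
  rewrite exchange_big; apply: eq_bigr => y _.
  rewrite exchange_big; apply: eq_bigr => z _ /=.
  case: eqP => e.
    have wS : (y * z)%g \in S by apply: mS1; exists x, 1%g; rewrite mulg1 mulgA.
    rewrite (bigD1_seq (y * z)%g) //= mulgA e !eqxx big1 ?addr0 // => w.
    by rewrite eq_sym => /negPf ->; rewrite if_same.
  rewrite big1 // => w _; case: eqP => // e1; case: eqP => // e2.
  by case: e; rewrite -mulgA e2.
symmetry; rewrite (fs_mulE _ _ uS mS1).
transitivity (\sum_(w <- S) \sum_(z <- S) \sum_(x <- S) \sum_(y <- S)
   (if (w * z)%g == m then if (x * y)%g == w then T x y z else 0 else 0)).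
  apply: eq_big_seq => w wS; apply: eq_bigr => z _.
  case: eqP => _; last by rewrite big1 // => y _; rewrite big1.
  rewrite (fs_mulE _ _ uS); last by move=> ?; exact: mS2.
  rewrite mulr_suml; apply: eq_bigr => x _.
  rewrite mulr_suml; apply: eq_bigr => y _.
  by rewrite (fun_if (fun t => t * c z)) mul0r.
under eq_bigr do rewrite exchange_big /=.
rewrite exchange_big; apply: eq_bigr => x _ /=.
under eq_bigr do rewrite exchange_big /=.
rewrite exchange_big; apply: eq_bigr => y _ /=.
rewrite exchange_big; apply: eq_bigr => z _ /=.
case: eqP => e.
  have wS : (x * y)%g \in S by apply: mS1; exists 1%g, z; rewrite mul1g.
  rewrite (bigD1_seq (x * y)%g) //= e !eqxx big1 ?addr0 // => w.
  by rewrite eq_sym => /negPf ->; rewrite if_same.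
rewrite big1 // => w _; case: eqP => // e1; case: eqP => // e2.
by case: e; rewrite e2.
Qed.

Let fs_mul1r : left_id fs_one fs_mul.
Proof.
move=> a; apply/funext => m; rewrite /fs_mul -(fsbig_widen [set (1%g, m)]).
- by rewrite fsbig_set1 /fs_one eqxx mul1r.
- by move=> _ -> /=; rewrite mul1g.
move=> [x y] [/= <- ne]; rewrite /fs_one; case: eqP => [e|_]; last by rewrite mul0r.
by case: ne; rewrite e mul1g.
Qed.

Let fs_mulr1 : right_id fs_one fs_mul.
Proof.
move=> a; apply/funext => m; rewrite /fs_mul -(fsbig_widen [set (m, 1%g)]).
- by rewrite fsbig_set1 /fs_one eqxx mulr1.
- by move=> _ -> /=; rewrite mulg1.
move=> [x y] [/= <- ne]; rewrite /fs_one; case: eqP => [e|_]; last by rewrite mulr0.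
by case: ne; rewrite e mulg1.
Qed.

Let fs_mulDl : left_distributive fs_mul +%R.
Proof.
move=> a b c; apply/funext => m; rewrite /fs_mul.
have fF := @finite_factorizations M m.
rewrite [RHS]/GRing.add /= !fsbig_finite // -big_split.
by apply: eq_bigr => p _; exact: mulrDl.
Qed.

Let fs_mulDr : right_distributive fs_mul +%R.
Proof.
move=> a b c; apply/funext => m; rewrite /fs_mul.
have fF := @finite_factorizations M m.
rewrite [RHS]/GRing.add /= !fsbig_finite // -big_split.
by apply: eq_bigr => p _; exact: mulrDr.
Qed.

Let fs_one_neq0 : fs_one != 0.
Proof.
apply/eqP => /(congr1 (fun a : formalSum k M => a 1%g))/eqP.
by rewrite /fs_one eqxx oner_eq0.
Qed.

HB.instance Definition _ := GRing.Zmodule_isNzRing.Build (formalSum k M)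
  fs_mulA fs_mul1r fs_mulr1 fs_mulDl fs_mulDr fs_one_neq0.

Let fs_scaleAl (x : k) a b : x *: (a * b) = (x *: a) * b.
Proof.
apply/funext => m; have fF := @finite_factorizations M m.
rewrite -[LHS]/(x * fs_mul a b m) -[RHS]/(fs_mul (x *: a) b m) /fs_mul.
by rewrite !fsbig_finite // mulr_sumr; apply: eq_bigr => p _; exact: mulrA.
Qed.

Let fs_scaleAr (x : k) a b : x *: (a * b) = a * (x *: b).
Proof.
apply/funext => m; have fF := @finite_factorizations M m.
rewrite -[LHS]/(x * fs_mul a b m) -[RHS]/(fs_mul a (x *: b) m) /fs_mul.
by rewrite !fsbig_finite // mulr_sumr; apply: eq_bigr => p _; exact: mulrCA.
Qed.

HB.instance Definition _ :=
  GRing.Lmodule_isLalgebra.Build k (formalSum k M) fs_scaleAl.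
HB.instance Definition _ :=
  GRing.Lalgebra_isAlgebra.Build k (formalSum k M) fs_scaleAr.

End FormalSums.

(** * The center of an algebra *)

Section Center.
Variables (k : pzRingType) (R : algType k).

Definition central : pred R := fun x => `[< forall y, x * y = y * x >].

Let central_subalg : GRing.subalg_closed central.
Proof.
split=> [|c x y /asboolP cx /asboolP cy|x y /asboolP cx /asboolP cy];
  apply/asboolP => z.
- by rewrite mulr1 mul1r.
- by rewrite mulrDl mulrDr -scalerAl cx cy scalerAr.
- by rewrite -mulrA cy !mulrA cx.
Qed.

HB.instance Definition _ := GRing.isSubalgClosed.Build k R central central_subalg.

Definition center : Type := {x : R | central x}.
HB.instance Definition _ := [isSub of center for (@proj1_sig _ _)].
HB.instance Definition _ := [Choice of center by <:].
HB.instance Definition _ := [SubChoice_isSubLalgebra of center by <:].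

Let center_mulC : @commutative center center *%R.
Proof.
move=> x y; apply: val_inj; have /asboolP cx := valP x.
by rewrite !rmorphM /= cx.
Qed.
HB.instance Definition _ :=
  GRing.PzRing_hasCommutativeMul.Build center center_mulC.
HB.instance Definition _ := GRing.Lalgebra_isComAlgebra.Build k center.
End Center.

(** * Admissible data *)

Section GroupConjugacy.
Variable G : groupType.

Definition lconj (g h : G) : G := (g * h * g^-1)%g.

Definition conjugate (h h' : G) : bool := `[< exists g, lconj g h = h' >].

Let conjugate_equiv : equiv_class_of conjugate.
Proof.
split=> [h|h h'|h1 h2 h3 /asboolP[g <-] /asboolP[g' <-]].
- by apply/asboolP; exists 1%g; rewrite /lconj mul1g invg1 mulg1.
- by apply/idP/idP => /asboolP[g <-]; apply/asboolP; exists g^-1%g;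
    rewrite /lconj invgK !mulgA mulVg mul1g -mulgA mulVg mulg1.
- by apply/asboolP; exists (g' * g)%g; rewrite /lconj invgM !mulgA.
Qed.
Canonical conjugate_equivRel := EquivRelPack conjugate_equiv.

Definition conjClass : Type := {eq_quot conjugate}.
HB.instance Definition _ := Choice.on conjClass.
HB.instance Definition _ := EqQuotient.on conjClass.

Definition conj_class (h : G) : conjClass := \pi_conjClass h.

Lemma conj_classP h h' :
  conj_class h = conj_class h' <-> exists g, lconj g h = h'.
Proof. by split=> [/eqmodP/asboolP|?]; last exact/eqmodP/asboolP. Qed.

End GroupConjugacy.

(* A poset with a least element in which finite subsets have suprema is a join
   semilattice with bottom. The paper writes [x /\ y] for the supremum of [x]
   and [y]; here it is the join [x `|` y]. [eta x] is the subgroup [G_x]. *)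
Record groupData := GroupData {
  disp : Order.disp_t;
  Lam : bJoinSemilatticeType disp;
  grp : groupType;
  act : grp -> Lam -> Lam;
  eta : Lam -> set grp;
  act1 : forall x, act 1%g x = x;
  actM : forall g h x, act (g * h)%g x = act g (act h x);
  act_mono : forall g, {mono act g : x y / (x <= y)%O};
  eta_group : forall x, group_closed [in eta x];
  eta_homo : forall x y, (x <= y)%O -> eta x `<=` eta y;
  eta_act : forall g x, eta (act g x) = lconj g @` eta x
}.
Arguments Lam : clear implicits.
Arguments grp : clear implicits.
Arguments eta {_}.
Arguments act {_}.

Section Orbits.
Variable D : groupData.

Definition same_orbit (x y : Lam D) : bool := `[< exists g, act g x = y >].

Let same_orbit_equiv : equiv_class_of same_orbit.
Proof.
split=> [x|x y|x y z /asboolP[g <-] /asboolP[g' <-]].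
- by apply/asboolP; exists 1%g; rewrite act1.
- by apply/idP/idP => /asboolP[g <-]; apply/asboolP; exists g^-1%g;
    rewrite -actM mulVg act1.
- by apply/asboolP; exists (g' * g)%g; rewrite actM.
Qed.
Canonical same_orbit_equivRel := EquivRelPack same_orbit_equiv.

Definition orbits : Type := {eq_quot same_orbit}.
HB.instance Definition _ := Choice.on orbits.
HB.instance Definition _ := EqQuotient.on orbits.

Implicit Types l : orbits.

Definition orbit (x : Lam D) : orbits := \pi_orbits x.
Definition rep l : Lam D := repr l.

Lemma orbitP x y : orbit x = orbit y <-> exists g, act g x = y.
Proof. by split=> [/eqmodP/asboolP|?]; last exact/eqmodP/asboolP. Qed.

Lemma rep_orbit l : orbit (rep l) = l.
Proof. exact: reprK. Qed.

Definition orbit_le l' l'' : Prop :=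
  exists x' x'', [/\ orbit x' = l', orbit x'' = l'' & (x' <= x'')%O].

(* The paper's [l' /\ l'']: a set of orbits, not a single orbit. *)
Definition orbit_join l' l'' : set orbits :=
  [set l | exists x' x'',
     [/\ orbit x' = l', orbit x'' = l'' & orbit (x' `|` x'')%O = l]].

(* By [eta_act] this set of subgroups is a full conjugacy class, [G_l]. *)
Definition orbit_groups l : set (set (grp D)) :=
  [set H | exists2 x, orbit x = l & eta x = H].

(* The action of [G] on partial elements. *)
Definition pact (g : grp D) (p : Lam D * grp D) := (act g p.1, lconj g p.2).

End Orbits.

Record admissibleData := AdmissibleData {
  base :> groupData;
  below_finite : forall x : Lam base, finite_set [set y | (y <= x)%O];
  eta_bot : eta (\bot%O : Lam base) = [set 1%g];
  eta_finite : forall x : Lam base, finite_set (eta x);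
  orbit_join_finite : forall l' l'' : orbits base,
    finite_set (orbit_join l' l'');
  orbit_separated : forall l' l'' : orbits base,
    (forall l, orbit_join l' l = orbit_join l'' l) ->
    orbit_groups l' = orbit_groups l'' -> l' = l'';
  partial_conj : forall (x x' x'' : Lam base) (h' h'' : grp base),
    (x' <= x)%O -> (x'' <= x)%O -> eta x' h' -> eta x'' h'' ->
    (exists g, pact g (x', h') = (x'', h'')) ->
    exists2 g, eta x g & pact g (x', h') = (x'', h'');
  eta_cover : forall g : grp base, exists x, eta x g;
  eta_below : forall (x y : Lam base) g, eta x g -> (y <= x)%O -> (act g y <= x)%O;
  eta_conj : forall (x : Lam base) h h', eta x h -> eta x h' ->
    conj_class h = conj_class h' -> exists2 g, eta x g & lconj g h = h'
}.

Section Groups.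
Variable (D : admissibleData) (x : Lam D).

Definition etaGroup : Type := {h : grp D | h \in eta x}.
HB.instance Definition _ := [isSub of etaGroup for (@proj1_sig _ _)].
HB.instance Definition _ := [Choice of etaGroup by <:].
HB.instance Definition _ :=
  SubChoice_isSubGroup.Build (grp D) [in eta x] etaGroup (@eta_group D x).

Let etaGroup_finite : finite_set [set: etaGroup].
Proof.
apply: (@sub_finite_set _ _ ((val : etaGroup -> grp D) @^-1` eta x)).
  by move=> h _; exact/set_mem/(valP h).
by apply: finite_preimage (eta_finite x) => h h' _ _; exact: val_inj.
Qed.

Let etaGroup_factor (h : etaGroup) :
  finite_set [set p : etaGroup * etaGroup | (p.1 * p.2)%g = h].
Proof.
by apply: (@sub_finite_set _ _ ([set: etaGroup] `*` [set: etaGroup]));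
  [move=> ? | exact: finite_setX].
Qed.
HB.instance Definition _ := hasFiniteFactorizations.Build etaGroup etaGroup_factor.

End Groups.

Section PartialElements.
Variable D : admissibleData.

Definition partialElt : Type := {p : Lam D * grp D | p.2 \in eta p.1}.
HB.instance Definition _ := [isSub of partialElt for (@proj1_sig _ _)].
HB.instance Definition _ := [Choice of partialElt by <:].
Implicit Types p q r : partialElt.

Let mul_subproof p q :
  ((val p).2 * (val q).2)%g \in eta ((val p).1 `|` (val q).1)%O.
Proof.
have M := group_closedM (@eta_group D ((val p).1 `|` (val q).1)%O).
apply: M; apply/mem_set; [have /set_mem := valP p | have /set_mem := valP q];
  apply: eta_homo; [exact: leUl | exact: leUr].
Qed.

Let one_subproof : (1%g : grp D) \in eta (\bot%O : Lam D).
Proof. by have [] := @eta_group D (\bot%O : Lam D). Qed.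

Definition partial_mul p q : partialElt :=
  exist _ ((val p).1 `|` (val q).1, (val p).2 * (val q).2)%O%g (mul_subproof p q).

Definition partial_one : partialElt := exist _ (\bot%O, 1%g) one_subproof.

Let partial_mulA : associative partial_mul.
Proof. by move=> p q r; apply: val_inj; rewrite /= joinA mulgA. Qed.
Let partial_mul1 : left_id partial_one partial_mul.
Proof. by move=> [[x h] p]; apply: val_inj; rewrite /= join0x mul1g. Qed.
Let partial_mulr1 : right_id partial_one partial_mul.
Proof. by move=> [[x h] p]; apply: val_inj; rewrite /= joinx0 mulg1. Qed.

HB.instance Definition _ :=
  isMonoid.Build partialElt partial_mulA partial_mul1 partial_mulr1.

Let partial_factor r :
  finite_set [set t : partialElt * partialElt | (t.1 * t.2)%g = r].
Proof.
pose x := (val r).1; pose B := [set y | (y <= x)%O] `*` eta x.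
have fB : finite_set B.
  by apply: finite_setX; [exact: below_finite | exact: eta_finite].
have fB' : finite_set ((val : partialElt -> _) @^-1` B).
  by apply: finite_preimage fB => p q _ _; exact: val_inj.
apply: sub_finite_set (finite_setX fB' fB') => -[p q] /= e.
have px : ((val p).1 <= x)%O by rewrite /x -e leUl.
have qx : ((val q).1 <= x)%O by rewrite /x -e leUr.
by split; split=> //; [have /set_mem := valP p | have /set_mem := valP q];
  apply: eta_homo.
Qed.
HB.instance Definition _ :=
  hasFiniteFactorizations.Build partialElt partial_factor.

Implicit Types (l : orbits D) (c : conjClass (grp D)).

(* The conjugacy class [(l, c)] of partial elements, possibly empty. *)
Definition partial_class l c : set partialElt :=
  [set p | orbit (val p).1 = l /\ conj_class (val p).2 = c].

End PartialElements.

(* The intersection of the conjugacy class [c] with [G_x]. *)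
Definition class_in (D : admissibleData) c (x : Lam D) : set (grp D) :=
  [set h | eta x h /\ conj_class h = c].

Section Xi.
Variable D : admissibleData.
Implicit Types (x : Lam D) (h : grp D) (l : orbits D) (c : conjClass (grp D)).

Definition xi_at l' x h : nat :=
  #|` fset_set [set x' | [/\ orbit x' = l', (x' <= x)%O & eta x' h]]|.

(* The choices of [rep l] and of an element of the class are immaterial: see
   [xiE]. *)
Definition xi l' c l : nat :=
  if `[< class_in c (rep l) !=set0 >]
  then xi_at l' (rep l) (xget 1%g (class_in c (rep l))) else 0%N.

Lemma act_fix x g : eta x g -> act g x = x.
Proof.
move=> xg; apply/eqP; rewrite eq_le (eta_below xg (lexx x)) /=.
have xV : eta x g^-1%g.
  exact/set_mem/(group_closedV (@eta_group D x))/mem_set.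
by rewrite -(act_mono g^-1%g) -actM mulVg act1 (eta_below xV (lexx x)).
Qed.

Lemma xi_at_act g l' x h : xi_at l' (act g x) (lconj g h) = xi_at l' x h.
Proof.
rewrite /xi_at; set A := (X in fset_set X); set B := (X in _ = #|` fset_set X|).
have fB : finite_set B.
  by apply: sub_finite_set (below_finite x) => y [].
have -> : A = act g @` B.
  apply/seteqP; split=> y.
    move=> [oy yx hy]; exists (act g^-1%g y); last by rewrite -actM mulgV act1.
    split; first by rewrite -oy; apply/orbitP; exists g; rewrite -actM mulgV act1.
      by rewrite -(act_mono g) -actM mulgV act1.
    rewrite eta_act; exists (lconj g h) => //.
    by rewrite /lconj invgK !mulgA mulVg mul1g -mulgA mulVg mulg1.
  move=> [z [oz zx hz] <-]; split; last by rewrite eta_act; exists h.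
    by rewrite -oz; apply/esym/orbitP; exists g.
  by rewrite act_mono.
rewrite fset_set_image // card_imfset //= => y z /(congr1 (act g^-1%g)).
by rewrite -!actM mulVg !act1.
Qed.

Lemma xiE l' c l x h : orbit x = l -> class_in c x h -> xi l' c l = xi_at l' x h.
Proof.
move=> ox [xh hc]; rewrite -(rep_orbit l) in ox; have /orbitP[g gx] := ox.
have cg : class_in c (rep l) (lconj g h).
  split; first by rewrite -gx eta_act; exists h.
  by rewrite -hc; apply/esym/conj_classP; exists g.
rewrite /xi asboolT; last by exists (lconj g h).
have [r1 r2] : class_in c (rep l) (xget 1%g (class_in c (rep l))).
  exact: xgetPex (ex_intro _ _ cg).
have [u ru <-] : exists2 u, eta (rep l) u &
    lconj u (lconj g h) = xget 1%g (class_in c (rep l)).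
  by case: cg => a b; apply: eta_conj => //; rewrite b r2.
by rewrite -[in LHS](act_fix ru) -gx !xi_at_act.
Qed.

Lemma xi0 l' c l : ~ (class_in c (rep l) !=set0) -> xi l' c l = 0%N.
Proof. by move=> n; rewrite /xi asboolF. Qed.

End Xi.

(** * The algebra of conjugacy classes of partial elements *)

Section ClassSums.
Variables (k : fieldType) (D : admissibleData).
Local Notation P := (partialElt D).
Local Notation kP := (formalSum k P).
Implicit Types (a b : kP) (p q : P) (l : orbits D) (c : conjClass (grp D)).

(* [e_(l,c)], which is [0] when [(l, c)] is empty. *)
Definition class_sum l c : kP := fun p => (p \in partial_class l c)%:R.

Definition in_class_span : pred kP := fun a =>
  `[< exists s : seq (k * (orbits D * conjClass (grp D))),
        a = \sum_(t <- s) t.1 *: class_sum t.2.1 t.2.2 >].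

Let key p := (orbit (val p).1, conj_class (val p).2).

Let class_sumE t p : class_sum t.1 t.2 p = (key p == t)%:R.
Proof.
rewrite /class_sum; congr (_%:R); congr nat_of_bool.
case: t => l c; rewrite /key xpair_eqE /=.
apply/idP/andP; first by move=> /set_mem [-> ->].
by move=> [/eqP ? /eqP ?]; apply/mem_set.
Qed.

Let keyP p q : key p = key q <-> exists g, pact g (val p) = val q.
Proof.
split.
  case=> /orbitP[g gx] /conj_classP[u uh].
  have py : eta (val q).1 (lconj g (val p).2).
    by rewrite -gx eta_act; exists (val p).2 => //; exact/set_mem/(valP p).
  have qy : eta (val q).1 (val q).2 by exact/set_mem/(valP q).
  have [v vy e] : exists2 v, eta (val q).1 v & lconj v (lconj g (val p).2) = (val q).2.
    apply: eta_conj => //; apply/conj_classP; exists (u * g^-1)%g.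
    rewrite -uh /lconj invgM invgK !mulgA.
    by rewrite -!(mulgA _ g^-1%g g) !mulVg !mulg1.
  exists (v * g)%g; rewrite /pact actM gx act_fix // (surjective_pairing (val q)).
  by congr pair; rewrite -e /lconj invgM !mulgA.
case=> g; rewrite (surjective_pairing (val q)) => -[e1 e2]; congr pair.
  by apply/orbitP; exists g.
by apply/conj_classP; exists g.
Qed.

Let pact_proof g p : (pact g (val p)).2 \in eta (pact g (val p)).1.
Proof.
by apply/mem_set; rewrite eta_act; exists (val p).2 => //; exact/set_mem/(valP p).
Qed.
Let tr g p : P := exist _ (pact g (val p)) (pact_proof g p).

Let act_join g (x y : Lam D) : act g (x `|` y)%O = (act g x `|` act g y)%O.
Proof.
apply/eqP; rewrite eq_le; apply/andP; split; last first.
  by rewrite leUx !act_mono leUl leUr.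
rewrite -(act_mono g^-1%g) -actM mulVg act1 leUx.
by rewrite -[X in X && _](act_mono g) -[X in _ && X](act_mono g) -!actM mulgV !act1 leUl leUr.
Qed.

Let act_fix0 g : act g \bot%O = \bot%O :> Lam D.
Proof.
by apply/eqP; rewrite -lex0 -(act_mono g^-1%g) -actM mulVg act1 le0x.
Qed.

Let trM g p q : tr g (p * q)%g = (tr g p * tr g q)%g.
Proof.
apply: val_inj; rewrite /= /pact /= act_join; congr pair.
by rewrite /lconj !mulgA -!(mulgA _ g^-1%g g) mulVg mulg1.
Qed.

Let trK g : cancel (tr g) (tr g^-1%g).
Proof.
move=> p; apply: val_inj; rewrite /= /pact /= -actM mulVg act1.
by rewrite /lconj invgK !mulgA mulVg mul1g -mulgA mulVg mulg1 -surjective_pairing.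
Qed.
Let trVK g : cancel (tr g^-1%g) (tr g).
Proof.
move=> p; apply: val_inj; rewrite /= /pact /= -actM mulgV act1.
by rewrite /lconj invgK !mulgA mulgV mul1g -mulgA mulgV mulg1 -surjective_pairing.
Qed.

Let key_tr g p : key (tr g p) = key p.
Proof. by apply/esym/keyP; exists g. Qed.

Let inv a := forall p q, key p = key q -> a p = a q.

Let inv_tr a : (forall g p, a (tr g p) = a p) -> inv a.
Proof.
move=> H p q /keyP[g e]; rewrite -(H g p); congr a.
exact: val_inj.
Qed.

Lemma in_class_spanP a : in_class_span a <->
  (forall p q, orbit (val p).1 = orbit (val q).1 ->
     conj_class (val p).2 = conj_class (val q).2 -> a p = a q) /\
  finite_set [set t | exists2 p, a p != 0 & t = key p].
Proof.
split=> [/asboolP[s ->]|[ia fa]].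
  have E p : (\sum_(t <- s) t.1 *: class_sum t.2.1 t.2.2) p =
             \sum_(t <- s) t.1 * (key p == t.2)%:R.
    by rewrite fct_sumE; apply: eq_bigr => t _; rewrite -class_sumE.
  split=> [p q e1 e2|]; first by rewrite !E /key e1 e2.
  apply: (@sub_finite_set _ _ [set` [seq t.2 | t <- s]]); last first.
    exact: finite_seq.
  move=> t [p + ->]; rewrite E /= => /eqP ne.
  apply: contra_notT ne => ns; apply: big1_seq => u /andP[_ us].
  case: eqP => [e|_]; last by rewrite mulr0.
  by case/negP: ns; rewrite e map_f.
apply/asboolP; pose K := [set t | exists2 p, a p != 0 & t = key p].
pose co t := if pselect (exists p, key p = t) is left e then a (projT1 (cid e)) else 0.
exists [seq (co t, t) | t <- fset_set K].
apply/funext => p; rewrite big_map fct_sumE.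
have coE : co (key p) = a p.
  rewrite /co; case: pselect => [e|[]]; last by exists p.
  by case: cid => q /= [e1 e2]; apply: ia.
transitivity (\sum_(t <- fset_set K) if t == key p then a p else 0).
  have [Kp|nK] := boolP (key p \in fset_set K).
    rewrite (bigD1_seq (key p)) ?fset_uniq //; rewrite [key p == _]eqxx big1 => [|t /negPf -> //] /=.
    by rewrite addr0.
  rewrite big1_seq => [|t /= tK].
    apply/eqP; apply: contraNT nK => ap; rewrite in_fset_set // inE.
    by exists p.
  by case: eqP nK => // <-; rewrite tK.
apply: eq_bigr => t _; rewrite -[RHS]/(co t * class_sum t.1 t.2 p) class_sumE.
by rewrite eq_sym; case: eqP => [<-|_]; rewrite ?mulr1 ?mulr0 // coE.
Qed.

Let mul_inv a b : inv a -> inv b -> inv (a * b).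
Proof.
move=> ia ib; apply: inv_tr => g p; rewrite /GRing.mul /= /fs_mul.
rewrite (reindex_fsbig (fun t : P * P => (tr g t.1, tr g t.2))
  [set t | (t.1 * t.2)%g = p]).
  by apply: eq_fsbigr => t _ /=; congr (_ * _); [apply: ia|apply: ib];
    exact: key_tr.
split=> [t /= <-|t u _ _ /pair_equal_spec[e1 e2]|t /= e]; first by rewrite trM.
  by rewrite (surjective_pairing t) (surjective_pairing u);
    congr pair; apply: (can_inj (trK g)).
exists (tr g^-1%g t.1, tr g^-1%g t.2) => /=; first by rewrite -trM e trK.
by rewrite !trVK -surjective_pairing.
Qed.

Let mul_comm a b : inv b -> a * b = b * a.
Proof.
move=> ib; apply/funext => m; rewrite /GRing.mul /= /fs_mul.
have fixr p q : (tr (val p).2 q * p = p * q)%g.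
  apply: val_inj; rewrite /= /pact /=; congr pair; last first.
    by rewrite /lconj -!mulgA mulVg mulg1.
  have px : eta (val p).1 (val p).2 by exact/set_mem/(valP p).
  rewrite -[in X in (_ `|` X)%O](act_fix px) -act_join joinC act_fix //.
  by apply: eta_homo px; exact: leUl.
rewrite [RHS](reindex_fsbig (fun t : P * P => (tr (val t.1).2 t.2, t.1))
  [set t | (t.1 * t.2)%g = m]).
  by apply: eq_fsbigr => t _ /=; rewrite mulrC; congr (_ * _); apply: ib; rewrite key_tr.
split=> [t /= <-|t u _ _ /pair_equal_spec[e1 e2]|[q p] /= e]; first by rewrite fixr.
  rewrite (surjective_pairing t) (surjective_pairing u) e2; congr pair.
  by move: e1; rewrite e2 => /(can_inj (trK _)).
by exists (p, tr (val p).2^-1%g q) => /=; rewrite ?trVK // -fixr // trVK.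
Qed.

Let class_span_inv a : in_class_span a -> inv a.
Proof. by case/in_class_spanP => ia _ p q [e1 e2]; exact: ia. Qed.

Lemma class_span_mulC a b : in_class_span b -> a * b = b * a.
Proof. by move/class_span_inv/mul_comm. Qed.

Lemma class_sum_span l c : in_class_span (class_sum l c).
Proof. by apply/asboolP; exists [:: (1, (l, c))]; rewrite big_seq1 scale1r. Qed.

Let class_span_subalg : GRing.subalg_closed in_class_span.
Proof.
split=> [|x a b /asboolP[s ->] /asboolP[s' ->]|a b Aa Ab].
- suff -> : 1 = class_sum (orbit \bot%O) (conj_class 1%g) by exact: class_sum_span.
  apply/funext => p; rewrite (class_sumE (_, _)) -[LHS]/(p == 1%g)%:R.
  congr (_%:R); congr nat_of_bool; apply/eqP/eqP => [-> //|].
  move=> /esym/(keyP 1%g)[g e]; apply: val_inj; rewrite -e /pact /=.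
  by rewrite /lconj mulg1 mulgV act_fix0.
- apply/asboolP; exists ([seq (x * t.1, t.2) | t <- s] ++ s').
  rewrite big_cat big_map scaler_sumr /=; congr (_ + _).
  by apply: eq_bigr => t _; rewrite scalerA.
apply/in_class_spanP; split.
  by move=> p q e1 e2; apply: mul_inv; rewrite ?/key ?e1 ?e2 //; exact: class_span_inv.
have /in_class_spanP[_ fa] := Aa; have /in_class_spanP[_ fb] := Ab.
set Ka := [set t | _] in fa; set Kb := [set t | _] in fb.
pose J := \bigcup_(t in Ka `*` Kb) orbit_join t.1.1 t.2.1.
have fJ : finite_set J.
  by apply: bigcup_finite => [|t _]; [exact: finite_setX|exact: orbit_join_finite].
have fU : finite_set (\bigcup_(l in J) [set (l, conj_class h) | h in eta (rep l)]).
  by apply: bigcup_finite => // l _; apply: finite_image; exact: eta_finite.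
apply: sub_finite_set fU => t [m ab0 ->].
have [[p q] /= e [ap bq]] : exists2 u : P * P, (u.1 * u.2)%g = m & a u.1 != 0 /\ b u.2 != 0.
  apply: contrapT => N; case/eqP: ab0; rewrite /GRing.mul /= /fs_mul.
  apply: fsbig1 => u /= um; apply: contrapT => /eqP; rewrite mulf_eq0 negb_or.
  by move=> /andP[? ?]; apply: N; exists u.
exists (orbit (val m).1).
  exists (key p, key q); first by split; [exists p|exists q].
  by exists (val p).1, (val q).1; split=> //; rewrite -e.
have /orbitP[g gx] : orbit (val m).1 = orbit (rep (orbit (val m).1)).
  by rewrite rep_orbit.
exists (lconj g (val m).2); last first.
  by congr pair; apply/esym/conj_classP; exists g.
by rewrite -gx eta_act; exists (val m).2 => //; exact/set_mem/(valP m).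
Qed.

HB.instance Definition _ :=
  GRing.isSubalgClosed.Build k kP in_class_span class_span_subalg.

(* [A(Lambda, G, eta)]: the nonzero class sums are the indicator functions of
   disjoint nonempty sets, hence a basis of their span. *)
Definition partialAlg : Type := {a : kP | in_class_span a}.
HB.instance Definition _ := [isSub of partialAlg for (@proj1_sig _ _)].
HB.instance Definition _ := [Choice of partialAlg by <:].
HB.instance Definition _ := [SubChoice_isSubLalgebra of partialAlg by <:].

Let partialAlg_mulC : @commutative partialAlg partialAlg *%R.
Proof.
by move=> a b; apply: val_inj; rewrite !rmorphM /= class_span_mulC // (valP b).
Qed.
HB.instance Definition _ :=
  GRing.PzRing_hasCommutativeMul.Build partialAlg partialAlg_mulC.
HB.instance Definition _ := GRing.Lalgebra_isComAlgebra.Build k partialAlg.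

Definition class_elt l c : partialAlg := exist _ (class_sum l c) (class_sum_span l c).

End ClassSums.

(** * The product of the centers of the group algebras *)

Section HatAlgebra.
Variables (k : fieldType) (D : admissibleData).
Implicit Types (x : Lam D) (l : orbits D) (c : conjClass (grp D)).

Definition groupAlg x : algType k := formalSum k (etaGroup x).

Definition group_class_sum c x : groupAlg x :=
  fun h : etaGroup x => (val h \in class_in c x)%:R.
Arguments group_class_sum : clear implicits.

Lemma group_class_sum_central c x : central (group_class_sum c x).
Proof.
apply/asboolP => a; apply/funext => m; rewrite /GRing.mul /= /fs_mul.
rewrite [RHS](reindex_fsbig
  (fun t : etaGroup x * etaGroup x => (t.2, t.2^-1 * t.1 * t.2)%g)
  [set t | (t.1 * t.2)%g = m]).
  apply: eq_fsbigr => t _ /=; rewrite mulrC; congr (_ * _).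
  rewrite /group_class_sum; congr (_%:R); congr nat_of_bool.
  have E : conj_class (val (t.2^-1 * t.1 * t.2)%g) = conj_class (val t.1).
    by apply/conj_classP; exists (val t.2); rewrite /lconj /= !mulgA mulgV mul1g -mulgA mulgV mulg1.
  apply/idP/idP => /set_mem[_ e]; apply/mem_set; split.
  - exact/set_mem/valP.
  - by rewrite E.
  - exact/set_mem/valP.
  - by rewrite -E.
split=> [t /= <-|t u _ _ /pair_equal_spec[e1 e2]|[q p] /= e].
- by rewrite !mulgA mulgV mul1g.
- rewrite (surjective_pairing t) (surjective_pairing u) e1; congr pair.
  by move: e2; rewrite e1 => /mulIg/mulgI.
- by exists (q * p * q^-1, q)%g => /=; rewrite -?mulgA ?mulVg ?mulg1 ?mulKg.
Qed.

(* [e_(c(l))], for the representative [rep l] of the orbit [l] *)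
Definition central_class_sum c l : center (groupAlg (rep l)) :=
  exist _ (group_class_sum c (rep l)) (group_class_sum_central c (rep l)).

(* A family [a] stands for the possibly infinite sum [\sum_l a l]. *)
Definition hatAlg : Type := forall l, center (groupAlg (rep l)).
HB.instance Definition _ := gen_eqMixin hatAlg.
HB.instance Definition _ := gen_choiceMixin hatAlg.

Implicit Types a b : hatAlg.

Definition hat_zero : hatAlg := fun _ => 0.
Definition hat_one : hatAlg := fun _ => 1.
Definition hat_opp a : hatAlg := fun l => - a l.
Definition hat_add a b : hatAlg := fun l => a l + b l.
Definition hat_mul a b : hatAlg := fun l => a l * b l.
Definition hat_scale (t : k) a : hatAlg := fun l => t *: a l.

Local Ltac pointwise lem :=
  repeat move=> ?; apply: functional_extensionality_dep => ?; exact: lem.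

Let hat_addA : associative hat_add. Proof. pointwise addrA. Qed.
Let hat_addC : commutative hat_add. Proof. pointwise addrC. Qed.
Let hat_add0 : left_id hat_zero hat_add. Proof. pointwise add0r. Qed.
Let hat_addN : left_inverse hat_zero hat_opp hat_add. Proof. pointwise addNr. Qed.
HB.instance Definition _ :=
  GRing.isZmodule.Build hatAlg hat_addA hat_addC hat_add0 hat_addN.

Let hat_mulA : associative hat_mul. Proof. pointwise mulrA. Qed.
Let hat_mulC : commutative hat_mul. Proof. pointwise mulrC. Qed.
Let hat_mul1 : left_id hat_one hat_mul. Proof. pointwise mul1r. Qed.
Let hat_mulDl : left_distributive hat_mul hat_add. Proof. pointwise mulrDl. Qed.
Let hat_one_neq0 : hat_one != hat_zero.
Proof.
apply/eqP => /(congr1 (fun a : hatAlg => a (orbit \bot%O)))/eqP.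
by rewrite /hat_one /hat_zero oner_eq0.
Qed.
HB.instance Definition _ := GRing.Zmodule_isComNzRing.Build hatAlg
  hat_mulA hat_mulC hat_mul1 hat_mulDl hat_one_neq0.

Let hat_scaleA s t a : hat_scale s (hat_scale t a) = hat_scale (s * t) a.
Proof. pointwise scalerA. Qed.
Let hat_scale1 : left_id 1 hat_scale. Proof. pointwise scale1r. Qed.
Let hat_scaleDr : right_distributive hat_scale +%R. Proof. pointwise scalerDr. Qed.
Let hat_scaleDl a : {morph hat_scale^~ a : s t / s + t}.
Proof. pointwise scalerDl. Qed.
HB.instance Definition _ := GRing.Zmodule_isLmodule.Build k hatAlg
  hat_scaleA hat_scale1 hat_scaleDr hat_scaleDl.

Let hat_scaleAl (t : k) a b : t *: (a * b) = t *: a * b.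
Proof. pointwise scalerAl. Qed.
HB.instance Definition _ := GRing.Lmodule_isLalgebra.Build k hatAlg hat_scaleAl.
HB.instance Definition _ := GRing.Lalgebra_isComAlgebra.Build k hatAlg.

End HatAlgebra.

(* Main.v *)
(** For each [x], summing a formal sum of partial elements over the pairs
   [(y, h)] with [y <= x] gives a map to [k[G_x]]. It is multiplicative because
   [y `|` z <= x] iff [y <= x] and [z <= x]. On class sums it counts the [y]
   under [x] in a given orbit whose subgroup contains [h], which is [xi]. The
   maps are jointly injective by Moebius inversion on the finite sets of elements
   below [x]: the matrix is unitriangular, so this works in any characteristic. *)

From HB Require Import structures.
From mathcomp Require Import all_boot all_order all_algebra finmap.
From mathcomp Require Import all_classical.
Require Import Defs.

Set Implicit Arguments.
Unset Strict Implicit.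
Unset Printing Implicit Defensive.
Import Order.TTheory GRing.Theory.

Local Open Scope classical_set_scope.
Local Open Scope ring_scope.

(** Serves to group pairs of partial elements first by their product, then by their pair of group
    components. *)
Lemma partition_fsbig (R : Type) (idx : R) (op : Monoid.com_law idx)
    (I J : choiceType) (A : set I) (B : set J) (f : I -> J) (F : I -> R) :
  finite_set A -> finite_set B -> (forall i, A i -> B (f i)) ->
  \big[op/idx]_(i \in A) F i =
  \big[op/idx]_(j \in B) \big[op/idx]_(i \in A `&` f @^-1` [set j]) F i.
Proof.
move=> fA fB AB; under [RHS]eq_fsbigr do rewrite fsbig_mkcondr.
rewrite exchange_fsbig //; apply: eq_fsbigr => i /set_mem /AB Bfi.
rewrite (fsbigD1 (f i)) //= mem_set // fsbig1 ?Monoid.mulm1 // => j [_ /= ne].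
by rewrite memNset // => e; apply: ne.
Qed.

(** * Restriction of formal sums to the group algebra of [G_x] *)

Section Restriction.
Variables (k : fieldType) (D : admissibleData).
Local Notation P := (partialElt D).
Local Notation kP := (formalSum k P).
Implicit Types (x y : Lam D) (g h : grp D) (p q : P) (a b : kP).

Definition below_fiber x h : set P :=
  [set p | ((val p).1 <= x)%O /\ (val p).2 = h].

(** Monotonicity of [eta] embeds this set in the product of the down-set of [x] with [G_x], both
    finite. *)
Lemma below_elts_finite x : finite_set [set p : P | ((val p).1 <= x)%O].
Proof.
have fB : finite_set ([set y | (y <= x)%O] `*` eta x).
  by apply: finite_setX; [exact: below_finite|exact: eta_finite].
have fV : finite_set ((val : P -> _) @^-1` ([set y | (y <= x)%O] `*` eta x)).
  by apply: finite_preimage fB => p q _ _; exact: val_inj.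
apply: sub_finite_set fV => p /= px; split=> //=.
by apply: eta_homo px _ _; exact/set_mem/(valP p).
Qed.

Lemma below_fiber_finite x h : finite_set (below_fiber x h).
Proof. by apply: sub_finite_set (below_elts_finite x) => p []. Qed.

Definition restr x a : groupAlg k x :=
  fun h : etaGroup x => \sum_(p \in below_fiber x (val h)) a p.
Arguments restr : clear implicits.

Lemma restr_linear x (t : k) a b :
  restr x (t *: a + b) = t *: restr x a + restr x b.
Proof.
apply/funext => h; rewrite /restr.
rewrite [LHS](@fsbig_split _ _ 0 _ _ (fun p => t * a p) b); last first.
  exact: below_fiber_finite.
by rewrite -mulr_fsumr.
Qed.

Lemma restrM x a b : restr x (a * b) = restr x a * restr x b.
Proof.
apply/funext => h; rewrite /restr [in LHS]/GRing.mul [in RHS]/GRing.mul /= /fs_mul.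
(* Both sides become one sum over [T]: the left by grouping pairs by their product in [P], the right
   by grouping them by their two group components. *)
pose T := [set t : P * P | [/\ ((val t.1).1 <= x)%O, ((val t.2).1 <= x)%O &
  ((val t.1).2 * (val t.2).2)%g = val h]].
have fT : finite_set T.
  apply: sub_finite_set (finite_setX (below_elts_finite x) (below_elts_finite x)).
  by move=> t [].
transitivity (\sum_(t \in T) a t.1 * b t.2).
  rewrite (@partition_fsbig _ _ _ _ _ T (below_fiber x (val h))
    (fun t : P * P => (t.1 * t.2)%g)) //; last first.
  - by move=> t [t1 t2 e]; split=> //=; rewrite leUx t1 t2.
  - exact: below_fiber_finite.
  apply: eq_fsbigr => m /set_mem [mx mh]; apply: eq_fsbigl.
  apply/seteqP; split=> t /=; last by case.
  move=> e; split=> //; move: mx mh; rewrite -e /= leUx => /andP[? ?] mh.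
  by split.
(* The default [1] is never taken on [T]: below [x] the group component lies in [G_x]. *)
pose u p : etaGroup x := insubd (1%g : etaGroup x) (val p).2.
have uE p : ((val p).1 <= x)%O -> val (u p) = (val p).2.
  move=> px; rewrite /u insubdK //; apply/mem_set.
  by apply: eta_homo px _ _; exact/set_mem/(valP p).
rewrite (@partition_fsbig _ _ _ _ _ T
    [set w : etaGroup x * etaGroup x | (w.1 * w.2)%g = h]
    (fun t : P * P => (u t.1, u t.2))) //; last first.
- by move=> t [t1 t2 e] /=; apply: val_inj; rewrite /= !uE.
- exact: finite_factorizations.
apply: eq_fsbigr => w /set_mem /= wh.
rewrite mulr_fsuml; under [RHS]eq_fsbigr do rewrite mulr_fsumr.
rewrite pair_fsbig; [|exact: below_fiber_finite..].
apply: eq_fsbigl; apply/seteqP; split=> -[p q] /=.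
  by move=> [[/= px qx _] <-]; split; split; rewrite //= uE.
move=> [[px pw] [qx qw]]; split=> /=; first by split; rewrite //= pw qw -wh.
by rewrite (surjective_pairing w); congr pair; apply: val_inj; rewrite uE.
Qed.

Lemma restr1 x : restr x 1 = 1.
Proof.
have oneE (M : ffMonoidType) (m : M) :
  (1 : formalSum k M) m = (m == 1%g)%:R by [].
apply/funext => h; rewrite /restr [RHS]oneE.
have [->|hN1] := eqVneq h 1%g; last first.
  rewrite fsbig1 // => p [_ ph]; rewrite oneE.
  by case: eqP ph => // -> /= h1; case/eqP: hN1; exact: val_inj.
rewrite (fsbigD1 (1%g : P)) /=; first last.
- by split=> //=; exact: le0x.
- exact: below_fiber_finite.
rewrite oneE eqxx fsbig1 ?addr0 // => p [_ /eqP pN1].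
by rewrite oneE (negPf pN1).
Qed.

(** * Conjugation invariance and centrality *)

Definition conj_invariant a := forall p q,
  orbit (val p).1 = orbit (val q).1 ->
  conj_class (val p).2 = conj_class (val q).2 -> a p = a q.

Lemma span_conj_invariant a : in_class_span a -> conj_invariant a.
Proof. by case/in_class_spanP. Qed.

Lemma lconjK g : cancel (lconj g) (lconj g^-1%g).
Proof.
by move=> h; rewrite /lconj invgK !mulgA mulVg mul1g -mulgA mulVg mulg1.
Qed.

(** Translation by [g] is a bijection between the two fibers and preserves the values of [a]. With
    [g] in [G_x] this yields centrality; with general [g] it moves between points of one orbit. *)
Lemma restr_act g a x (h : etaGroup x) (h' : etaGroup (act g x)) :
  conj_invariant a -> val h' = lconj g (val h) ->
  restr (act g x) a h' = restr x a h.
Proof.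
move=> ia hh; rewrite /restr hh.
have pP g' p : (pact g' (val p)).2 \in eta (pact g' (val p)).1.
  by apply/mem_set; rewrite eta_act; exists (val p).2 => //; exact/set_mem/(valP p).
pose tr g' p : P := exist _ (pact g' (val p)) (pP g' p).
have trK g' p : tr g'^-1%g (tr g' p) = p.
  apply: val_inj; rewrite /= /pact /= lconjK -actM mulVg act1.
  by rewrite -surjective_pairing.
rewrite (@reindex_fsbig _ _ _ _ _ (tr g) (below_fiber x (val h))); last first.
  split=> [p [px ph]|p q _ _ /(congr1 (tr g^-1%g))|q [qx qh]].
  - by split; rewrite /= ?act_mono ?ph.
  - by rewrite !trK.
  exists (tr g^-1%g q); last by rewrite -{1}(invgK g) trK.
  split=> /=; last by rewrite qh lconjK.
  by rewrite -(act_mono g) -actM mulgV act1.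
apply: eq_fsbigr => p _; apply: ia.
  by apply/esym/orbitP; exists g.
by apply/esym/conj_classP; exists g.
Qed.

(** Since [G_x] fixes [x], [restr_act] makes [restr x a] a class function on [G_x]. *)
Lemma restr_central x a : conj_invariant a -> central (restr x a).
Proof.
move=> ia; apply/asboolP => b; apply/funext => m.
rewrite /GRing.mul /= /fs_mul.
(* Writing [s * t] as [t * (t^-1 * s * t)] swaps the factors at the cost of conjugating [s], which a
   class function does not see. *)
rewrite [RHS](reindex_fsbig
  (fun t : etaGroup x * etaGroup x => (t.2, t.2^-1 * t.1 * t.2)%g)
  [set t | (t.1 * t.2)%g = m]).
  apply: eq_fsbigr => t _ /=; rewrite mulrC; congr (_ * _).
  have gx : eta x (val t.2) by exact/set_mem/valP.
  have := @restr_act (val t.2) a x (t.2^-1 * t.1 * t.2)%g.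
  rewrite (act_fix gx) => -> //.
  by rewrite /lconj /= !mulgA mulgV mul1g -mulgA mulgV mulg1.
split=> [t /= <-|t u _ _ /pair_equal_spec[e1 e2]|[q p] /= e].
- by rewrite !mulgA mulgV mul1g.
- rewrite (surjective_pairing t) (surjective_pairing u) e1; congr pair.
  by move: e2; rewrite e1 => /mulIg/mulgI.
- by exists (q * p * q^-1, q)%g => /=; rewrite -?mulgA ?mulVg ?mulg1 ?mulKg.
Qed.

(** * Values on class sums *)

(** Over a fixed [h] in [c], a partial element is determined by its first component, so the sum
    counts the points that [xi_at] counts. For [h] outside [c] both sides vanish. *)
Lemma restr_class_sum l' c l (h : etaGroup (rep l)) :
  restr (rep l) (class_sum k l' c) h =
  (xi l' c l)%:R * group_class_sum k c h.
Proof.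
have hl : eta (rep l) (val h) by exact/set_mem/valP.
rewrite /restr /group_class_sum.
have [hc|hc] := pselect (conj_class (val h) = c); last first.
  rewrite memNset ?mulr0; last by case.
  rewrite fsbig1 // => p [_ ph]; rewrite /class_sum memNset // => -[_].
  by rewrite ph.
rewrite mem_set ?mulr1 //.
(* Moves the count from the chosen element of the class to [h] itself. *)
rewrite (@xiE _ l' c l (rep l) (val h) (rep_orbit l)) // /xi_at.
set X := [set x' | _].
have fX : finite_set X by apply: sub_finite_set (below_finite (rep l)) => y [].
transitivity (\sum_(y \in X) (1 : k)).
  rewrite (@reindex_fsbig _ _ _ _ _ (fun p : P => (val p).1)
    (below_fiber (rep l) (val h) `&` partial_class l' c) X).
    rewrite [RHS]fsbig_mkcondr; apply: eq_fsbigr => p _.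
    by rewrite /class_sum; case: (_ \in _).
  split=> [p [[px ph] [pl _]]|p q /set_mem[[_ ph] _] /set_mem[[_ qh] _] e|y [yl yx yh]].
  - by split=> //; rewrite -ph; exact/set_mem/(valP p).
  - apply: val_inj; rewrite (surjective_pairing (val p)) e ph -qh.
    by rewrite -surjective_pairing.
  by exists (exist _ (y, val h) (mem_set yh)).
rewrite fsbig_finite // big_const_seq count_predT.
by rewrite -Monoid.iteropE.
Qed.

Lemma restr_class_sum_not_le l' c l (h : etaGroup (rep l)) :
  ~ orbit_le l' l -> restr (rep l) (class_sum k l' c) h = 0.
Proof.
move=> nle; rewrite /restr fsbig1 // => p [px _].
rewrite /class_sum memNset // => -[pl _]; apply: nle.
by exists (val p).1, (rep l); split=> //; exact: rep_orbit.
Qed.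

(* [restr x a h] is [a (x, h)] plus values of [a] strictly below [x]. *)
Lemma restr_inj a : (forall x, restr x a = 0) -> a = 0.
Proof.
move=> a0; apply/funext => p.
have [n] := ubnP #|` fset_set [set y | (y <= (val p).1)%O]|.
elim: n p => // n IH p; rewrite ltnS => pn.
have fB y := below_finite y.
pose h : etaGroup (val p).1 := exist _ (val p).2 (valP p).
have := congr1 (fun b : groupAlg k (val p).1 => b h) (a0 (val p).1).
rewrite /restr (fsbigD1 p) //=; last exact: below_fiber_finite.
(* Elements of the fiber share their group component, so [q] differs from [p] in its first
   component; its down-set is then strictly smaller and the induction applies. *)
rewrite fsbig1 ?addr0 // => q [[qp qh] qNp].
apply: IH; apply: leq_trans pn; apply: fproper_ltn_card.
rewrite fproperEneq; apply/andP; split; last first.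
  apply/fsubsetP => y; rewrite !in_fset_set // => /set_mem /= yq.
  by apply/mem_set; exact: le_trans yq qp.
apply/eqP => /fsetP /(_ (val p).1); rewrite !in_fset_set //.
rewrite [in RHS]mem_set /= ?lexx // => /set_mem /= pq.
apply: qNp; apply: val_inj; rewrite (surjective_pairing (val q)) qh.
rewrite (@le_anti _ _ (val q).1 (val p).1) -?surjective_pairing //.
by rewrite qp pq.
Qed.

(** * Assembly into an injective algebra morphism *)

Definition restr_hat (a : partialAlg k D) : hatAlg k D := fun l =>
  exist _ (restr (rep l) (val a))
    (restr_central (rep l) (span_conj_invariant (valP a))).

Lemma restr_hat_is_linear : linear restr_hat.
Proof.
move=> t a b; apply: functional_extensionality_dep => l; apply: val_inj.
exact: restr_linear.
Qed.

Lemma restr_hat_is_monoid_morphism : monoid_morphism restr_hat.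
Proof.
split=> [|a b]; apply: functional_extensionality_dep => l; apply: val_inj.
  exact: restr1.
exact: restrM.
Qed.

HB.instance Definition _ := GRing.isLinear.Build k (partialAlg k D)
  (hatAlg k D) _ restr_hat restr_hat_is_linear.
HB.instance Definition _ := GRing.isMonoidMorphism.Build (partialAlg k D)
  (hatAlg k D) restr_hat restr_hat_is_monoid_morphism.

(** The kernel condition speaks only of orbit representatives; invariance carries it to every [x],
    where [restr_inj] applies. *)
Lemma restr_hat_inj : injective restr_hat.
Proof.
apply: raddf_inj => a a0; apply: val_inj; apply: restr_inj => x.
have /orbitP[g gx] : orbit x = orbit (rep (orbit x)) by rewrite rep_orbit.
have := congr1 (fun b : hatAlg k D => val (b (orbit x))) a0.
move=> /= {}a0; apply/funext => h.
have hg : lconj g (val h) \in eta (act g x).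
  by apply/mem_set; rewrite eta_act; exists (val h) => //; exact/set_mem/valP.
have ia := span_conj_invariant (valP a).
(* Abstracting the conjugate as [e] lets its type be rewritten along [gx]. *)
have [e eh] : exists e : etaGroup (act g x), val e = lconj g (val h).
  by exists (Sub (lconj g (val h)) hg).
by rewrite -(restr_act ia eh); move: e {eh}; rewrite gx a0.
Qed.

End Restriction.

Theorem theorem6p1 (k : fieldType) (D : admissibleData) :
  exists phi : {lrmorphism partialAlg k D -> hatAlg k D},
    (forall (l' : orbits D) (c : conjClass (grp D)) (l : orbits D),
       phi (class_elt k l' c) l =
       if `[< orbit_le l' l >] then (xi l' c l)%:R *: central_class_sum k c l
       else 0)
    /\ injective phi.
Proof.
exists (@restr_hat k D); split=> [l' c l|]; last exact: restr_hat_inj.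
apply: val_inj; apply/funext => h.
case: asboolP => le_l; last exact: restr_class_sum_not_le.
exact: restr_class_sum.
Qed.
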